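(* In OmniLedger with $n$ parties, $m$ shards, at most $pn$ corrupted parties and per-shard consensus resilience $a$, the throughput factor is $$\sigma=\mu\cdot\tau\cdot\frac{m}{v}<\frac{\mu\cdot\tau\cdot f(n)}{v},\qquad f(n)=\frac{n}{c'\log\left(\frac{n}{c'\log n}\right)},$$ where $c'=c/p$ and $c$ is a constant such that $pn=c\,m\log m$ and $\frac{c}{d_c}>\frac{p}{a}$, with $d_c$ the solution $x>c$ of $1+x(\log c-\log x+1)-c=0$.
   Context: Transactions spend unspent transaction outputs (UTXOs) and create new ones; $v$ is the average number of inputs and outputs of a transaction in the input transaction set $T$, and UTXOs are partitioned uniformly at random among the $m$ shards. Each shard runs a consensus protocol with chain growth parameter $\tau$ (for any honest party, in any $s$ rounds at least $\tau s$ blocks are added to its chain) and chain quality parameter $\mu$ (among any $l$ consecutive blocks of an honest party's chain the ratio of honest blocks is at least $\mu$). $a$ is the resilience of the consensus protocol: a shard is secure if at least a fraction $1-a$ of its parties is honest; $p$ is the fraction of corrupted parties in the whole system ($p<a$; in OmniLedger $p<1/4$, $a=1/3$). Degree of parallelism: $m'=\frac{|T|\,m}{\sum_{j=1}^{|T|}\sum_{i=1}^{m}m_{i,j}}$, where $m_{i,j}=1$ if the $j$-th transaction of $T$ has an input or an output assigned to the $i$-th shard and $m_{i,j}=0$ otherwise. Throughput factor: $\sigma=\mu\cdot\tau\cdot m'$ (average number of blocks processed per round); with transactions spread uniformly the expected $m'$ is taken to be $m/v$. OmniLedger: in each epoch the $n$ parties are assigned to $m$ shards by a uniformly random permutation derived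 from an unbiasable common random value, and all shards must be secure with probability $1-o(1)$. A cross-shard transaction is processed by the atomic commit protocol Atomix, which involves only the shards holding the inputs and outputs of the transaction, hence at most $v$ shards per transaction.
   Formalization: The bound is claimed only for all sufficiently large n, uniformly for the constant c in a fixed compact interval of positive reals, since f(n) can be negative or undefined for small n (e.g. m = 2); the expected m' is assumed equal to m/v. *)

(* Defs.v *)
From HB Require Import structures.
From mathcomp Require Import all_boot all_order all_algebra all_fingroup.
From mathcomp Require Import all_classical all_reals all_analysis.

Set Implicit Arguments.
Unset Strict Implicit.
Unset Printing Implicit Defensive.

Import Order.TTheory GRing.Theory Num.Theory.
Import numFieldNormedType.Exports.
Local Open Scope ring_scope.

(* One epoch of the system. [placement] is the law of the random map that
   sends each UTXO to a shard. A block is identified with the party that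
   produced it, and [chain s x r] is the chain held at round [r] by party [x]
   when the parties are assigned to the shards by the permutation [s]. *)
Record omniledger (R : realType) := Omniledger {
  parties : nat;
  shards : nat;
  corrupted : {set 'I_parties};
  utxo : finType;
  tx : finType;
  inputs : tx -> {set utxo};
  outputs : tx -> {set utxo};
  placement : {ffun utxo -> 'I_shards} -> R;
  chain : {perm 'I_parties} -> 'I_parties -> nat -> seq 'I_parties
}.

Section Transactions.
Variables (R : realType) (S : omniledger R).

Definition wf_transactions :=
  (0 < #|tx S|)%N /\
  forall j : tx S, [disjoint inputs j & outputs j] /\
                   inputs j :|: outputs j != finset.set0.

Definition avg_io : R :=
  (\sum_(j : tx S) (#|inputs j| + #|outputs j|))%N%:R / #|tx S|%:R.

Definition involves (loc : {ffun utxo S -> 'I_(shards S)})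
    (j : tx S) (i : 'I_(shards S)) : bool :=
  [exists u in inputs j :|: outputs j, loc u == i].

Definition parallelism (loc : {ffun utxo S -> 'I_(shards S)}) : R :=
  #|tx S|%:R * (shards S)%:R /
  (\sum_(j : tx S) \sum_(i < shards S) (involves loc j i : nat))%N%:R.

Definition uniform_placement :=
  [/\ forall loc, 0 <= placement (o := S) loc,
      \sum_loc placement (o := S) loc = 1 &
      forall (u : utxo S) (i : 'I_(shards S)),
        \sum_(loc : {ffun utxo S -> 'I_(shards S)} | loc u == i)
           placement loc = (shards S)%:R^-1].

(* The value m / v of this expectation is a modelling convention: the
   expectation is never smaller, and it equals m / v exactly when almost surely
   no two UTXOs of one transaction share a shard. Independent uniform placement
   has such collisions, so it attains m / v only approximately; for this reason
   [uniform_placement] constrains only the law of each single UTXO. *)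
Definition expected_parallelism : R :=
  \sum_loc placement loc * parallelism loc.

End Transactions.

Section Security.
Variables (R : realType) (S : omniledger R).

(* The permuted list of parties is dealt round-robin to the shards, so that
   shard sizes differ by at most one. *)
Definition shard (s : {perm 'I_(parties S)}) (i : 'I_(shards S)) :
    {set 'I_(parties S)} :=
  [set x | (s x %% shards S == i)%N]%SET.

Definition secure (a : R) (s : {perm 'I_(parties S)}) (i : 'I_(shards S)) :
    bool :=
  (1 - a) * #|shard s i|%:R <= #|shard s i :\: corrupted S|%:R.

Definition prob_all_secure (a : R) : R :=
  #|[set s : {perm 'I_(parties S)} | [forall i, secure a s i]]%SET|%:R /
  ((parties S)`!)%:R.

(* Chain growth with parameters (tau, s) and chain quality with parameters
   (mu, l): s is the number of rounds and l the number of blocks of the window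
   over which the property is measured. *)
Definition chain_growth (B : Type) (tau : R) (s : nat) (C : nat -> seq B) :=
  forall r, (size (C r))%:R + tau * s%:R <= (size (C (r + s)%N))%:R.

Definition chain_quality (B : eqType) (honest : pred B) (mu : R) (l : nat)
    (C : nat -> seq B) :=
  forall r (w : seq B), infix w (C r) -> size w = l ->
    mu * l%:R <= (count honest w)%:R.

Definition consensus (a mu tau : R) (s l : nat) :=
  forall (pi : {perm 'I_(parties S)}) (i : 'I_(shards S)) x,
    secure a pi i -> x \in shard pi i -> x \notin corrupted S ->
    chain_growth tau s (chain pi x) /\
    chain_quality [pred y | y \notin corrupted S] mu l (chain pi x).

End Security.

Definition throughput_factor (R : realType) (mu tau m' : R) : R :=
  mu * tau * m'.

(* For 0 < c the solution d > c is unique. With c * m * ln m balls thrown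
   uniformly into m bins, the maximum load is about d * ln m. *)
Definition is_dc (R : realType) (c d : R) :=
  c < d /\ 1 + d * (ln c - ln d + 1) - c = 0.

Definition shard_bound (R : realType) (c' : R) (n : nat) : R :=
  n%:R / (c' * ln (n%:R / (c' * ln n%:R))).

(* Main.v *)
(* Since n = c' m ln m, the inequality m < f(n) says that
   ln (n / (c' ln n)) < ln m, that is m < n, that is 1 < c' ln m. It is
   meaningful only if that first logarithm is positive, i.e. c' ln n < n. As c
   stays in [c0, c1], both conditions hold once n exceeds constants depending
   on p, c0 and c1. *)
Require Import Defs.
From HB Require Import structures.
From mathcomp Require Import all_boot all_order all_algebra all_fingroup.
From mathcomp Require Import all_classical all_reals all_analysis.
From mathcomp Require Import ring lra.

Set Implicit Arguments.
Unset Strict Implicit.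
Unset Printing Implicit Defensive.

Import Order.TTheory GRing.Theory Num.Theory.
Import numFieldNormedType.Exports.
Local Open Scope classical_set_scope.
Local Open Scope ring_scope.

Lemma avg_io_gt0 (R : realType) (S : omniledger R) :
  wf_transactions S -> 0 < avg_io S.
Proof.
move=> [tx_gt0 wf]; apply: divr_gt0; rewrite ltr0n //.
have /card_gt0P [j _] := tx_gt0.
have [_ ioj] := wf j.
have io_gt0 : (0 < #|inputs j| + #|outputs j|)%N.
  by apply: leq_trans (leq_card_setU _ _); rewrite card_gt0.
by rewrite (bigD1 j) //= addn_gt0 io_gt0.
Qed.

(** With [L = ln x], squaring [expR (L / 2) >= 1 + L / 2] gives [x > L ^ 2 / 4], which exceeds
    [k * L] as soon as [L > 4 * k]. *)
Lemma lt_mul_ln (R : realType) (k x : R) :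
  0 < k -> expR (4 * k) < x -> k * ln x < x.
Proof.
move=> k_gt0 ltx.
have x_gt0 : 0 < x := lt_trans (expR_gt0 _) ltx.
have ltL : 4 * k < ln x by rewrite -ltr_expR lnK ?posrE.
have xE : x = expR (ln x / 2) * expR (ln x / 2).
  by rewrite -expRD -splitr lnK ?posrE.
have := expR_ge1Dx (ln x / 2).
rewrite [ltRHS]xE.
set e := expR _; set L := ln x in ltL *.
move=> leE; nra.
Qed.

Lemma lt_shard_bound (R : realType) (k x : R) (n : nat) :
  0 < k -> 0 < x -> (1 < n)%N -> n%:R = k * x * ln x ->
  1 < k * ln x -> k * ln n%:R < n%:R :> R -> x < shard_bound k n.
Proof.
move=> k_gt0 x_gt0 n_gt1 nE k_ln_gt1 ln_ltn.
have lnn_gt0 : 0 < ln n%:R :> R by rewrite ln_gt0 ?ltr1n.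
have klnn_gt0 : 0 < k * ln n%:R :> R by rewrite mulr_gt0.
have n_gt0 : 0 < n%:R :> R by rewrite ltr0n ltnW.
have x_ltn : x < n%:R by rewrite nE mulrAC ltr_pMl.
have q_gt1 : 1 < n%:R / (k * ln n%:R) :> R by rewrite ltr_pdivlMr ?mul1r.
(* Substituting [n = k * x * ln x] in the numerator only turns the quotient into [x * ln x / ln n],
   so [x < n] suffices. *)
have q_ltx : n%:R / (k * ln n%:R) < x.
  rewrite ltr_pdivrMr // [ltLHS]nE mulrA [x * k]mulrC ltr_pM2l ?mulr_gt0 //.
  by rewrite ltr_ln ?posrE.
rewrite /shard_bound ltr_pdivlMr ?mulr_gt0 ?ln_gt0 //.
rewrite mulrA [x * k]mulrC [ltRHS]nE ltr_pM2l ?mulr_gt0 //.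
by rewrite ltr_ln ?posrE // (lt_trans ltr01).
Qed.

(** By contraposition: a bounded [ln x] bounds [x * ln x], hence also [y]. The cut [p / c0] for
    [ln x] serves every [c >= c0], and [c1] bounds the factor [c] in [p * y]. *)
Lemma gt1_mul_ln (R : realType) (c c0 c1 p x y : R) :
  0 < p -> 0 < c0 -> c0 <= c <= c1 -> 0 < x -> p * y = c * x * ln x ->
  c1 / c0 * expR (p / c0) < y -> 1 < c / p * ln x.
Proof.
move=> p_gt0 c0_gt0 /andP[le0c lec1] x_gt0 yE lty.
have c_gt0 : 0 < c := lt_le_trans c0_gt0 le0c.
suff lnx : p / c0 < ln x.
  rewrite mulrAC ltr_pdivlMr // mul1r.
  move: lnx; rewrite ltr_pdivrMr // => lnx; nra.
rewrite ltNge; apply/negP => lnx.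
have xle : x <= expR (p / c0) by rewrite -ler_ln ?posrE ?expR_gt0 // expRK.
(* [ln x] may be negative here, so it is replaced by [p / c0] before [x] is bounded. *)
have xlnx : x * ln x <= expR (p / c0) * (p / c0).
  apply: le_trans (_ : x * (p / c0) <= _).
    by rewrite ler_pM2l.
  by rewrite ler_pM2r // divr_gt0.
have : p * y <= p * (c1 / c0 * expR (p / c0)).
  rewrite yE -mulrA.
  apply: le_trans (_ : c * (expR (p / c0) * (p / c0)) <= _).
    by rewrite ler_pM2l.
  apply: le_trans (_ : c1 * (expR (p / c0) * (p / c0)) <= _).
    by rewrite ler_wpM2r // mulr_ge0 ?expR_ge0 // ltW ?divr_gt0.
  by rewrite le_eqVlt; apply/orP; left; apply/eqP; field; rewrite gt_eqF.
by rewrite ler_pM2l // leNgt lty.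
Qed.

Theorem theorem42 (R : realType) (a p c0 c1 : R) (eps : nat -> R)
    (p_gt0 : 0 < p) (p_lt_a : p < a) (c0_gt0 : 0 < c0)
    (eps_o1 : eps n @[n --> \oo] --> (0 : R)) :
  exists N : nat,
  forall (S : omniledger R) (mu tau c dc : R) (s l : nat),
    let n := parties S in
    let m := shards S in
    let v := avg_io S in
    (N <= n)%N ->
    #|corrupted S|%:R <= p * n%:R ->
    1 - eps n <= prob_all_secure S a ->
    0 < mu -> 0 < tau -> (0 < s)%N -> (0 < l)%N ->
    consensus S a mu tau s l ->
    wf_transactions S ->
    uniform_placement S ->
    expected_parallelism S = m%:R / v ->
    c0 <= c <= c1 ->
    p * n%:R = c * m%:R * ln m%:R ->
    is_dc c dc ->
    p / a < c / dc ->
    let sigma := throughput_factor mu tau (expected_parallelism S) in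
    sigma = mu * tau * (m%:R / v) /\
    sigma < mu * tau * shard_bound (c / p) n / v.
Proof.
(* The three thresholds give in turn [0 < ln n], [1 < c / p * ln m] and [c / p * ln n < n],
   uniformly in [c]. *)
exists (maxn 2 (maxn (Num.truncn (c1 / c0 * expR (p / c0))).+1
                     (Num.truncn (expR (4 * (c1 / p)))).+1)).
move=> S mu tau c dc s l n m v.
rewrite !geq_max => /and3P[n_gt1 n_gtB n_gtE] _ _ mu_gt0 tau_gt0 _ _ _ wf _ parE.
move=> c_range nE _ _ sigma.
have sigmaE : sigma = mu * tau * (m%:R / v) by rewrite /sigma parE.
split=> //; rewrite {}sigmaE mulrA.
rewrite ltr_pM2r ?invr_gt0 ?avg_io_gt0 // ltr_pM2l ?mulr_gt0 //.
have {}n_gtB : c1 / c0 * expR (p / c0) < n%:R.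
  by apply: lt_le_trans (truncnS_gt _) _; rewrite ler_nat.
have {}n_gtE : expR (4 * (c1 / p)) < n%:R.
  by apply: lt_le_trans (truncnS_gt _) _; rewrite ler_nat.
have /andP[le0c lec1] := c_range.
have c_gt0 : 0 < c := lt_le_trans c0_gt0 le0c.
(* Without shards the right side of [nE] would vanish, while [p * n > 0]. *)
have m_gt0 : 0 < m%:R :> R.
  rewrite ltr0n lt0n; apply/eqP => m0; move/eqP: nE.
  by rewrite m0 mulr0 mul0r mulf_eq0 gt_eqF //= pnatr_eq0 -leqn0 leqNgt ltnW.
have lnn_gt0 : 0 < ln n%:R :> R by rewrite ln_gt0 ?ltr1n.
apply: lt_shard_bound => //.
- exact: divr_gt0.
- by rewrite -[LHS](mulKf (lt0r_neq0 p_gt0)) nE; ring.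
- exact: gt1_mul_ln nE n_gtB.
(* The threshold is built from [c1 / p], the largest possible [c / p]; since [ln n > 0], the bound
   passes down to [c / p]. *)
- have c1_gt0 : 0 < c1 := lt_le_trans c_gt0 lec1.
  apply: le_lt_trans (lt_mul_ln (divr_gt0 c1_gt0 p_gt0) n_gtE).
  by rewrite ler_pM2r // ler_pM2r ?invr_gt0.
Qed.
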